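(* For every transient Markov chain $\{X_t\}_{t\ge 0}$ (not necessarily reversible or irreducible) the expected number of cut-times is infinite, and hence the expected number of cutpoints of the path of the chain is infinite.
   Context: $\{X_t\}_{t\ge0}$ is a time-homogeneous Markov chain on a countable state space, started at a state $X_0$; it is transient, i.e. almost surely it visits every state only finitely many times. A cut-time is a time $t\ge 0$ such that the past $\{X_0,\dots,X_t\}$ is disjoint from the future $\{X_{t+1},X_{t+2},\dots\}$. The path of the chain is the (random) graph whose vertices are the states visited by the chain and whose edges are the pairs $\{X_t,X_{t+1}\}$, rooted at $X_0$. A vertex $x$ is a cutpoint of the path if it separates the root $X_0$ from infinity, i.e. removing $x$ would result in the root being in a finite connected component. *)

(* Defs.v *)
From Stdlib Require Export Relation_Operators.
From HB Require Export structures.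
From mathcomp Require Export all_boot all_order all_algebra.
From mathcomp Require Export all_classical all_reals all_analysis.

Set Implicit Arguments.
Unset Strict Implicit.
Unset Printing Implicit Defensive.

Import Order.TTheory GRing.Theory Num.Theory.
Import numFieldNormedType.Exports.

Local Open Scope classical_set_scope.
Local Open Scope ring_scope.
Local Open Scope ereal_scope.

Section trajectory.
Context {S : Type}.
Implicit Types (xs : nat -> S) (V : set S) (E : S -> S -> Prop).

Definition cut_times xs : set nat :=
  [set t | [set xs s | s in [set s | (s <= t)%N]] `&`
           [set xs s | s in [set s | (t < s)%N]] = set0].

Definition path_vertices xs : set S := range xs.

(* Equality of the unordered pairs {a, b} and {X_t, X_{t+1}}; when
   X_t = X_{t+1} this yields a loop, which is irrelevant to connectivity. *)
Definition path_edge xs (a b : S) : Prop :=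
  exists t, [set a; b] = [set xs t; xs t.+1].

(* Connected component of o in the subgraph of E induced on V; it is empty
   when o is not in V. *)
Definition component V E (o : S) : set S :=
  [set y | V o /\ clos_refl_trans S (fun a b => [/\ V a, V b & E a b]) o y].

(* The root itself satisfies this predicate: once it is removed, its component
   is empty. *)
Definition cutpoints xs : set S :=
  [set z | path_vertices xs z /\
    finite_set (component (path_vertices xs `\ z) (path_edge xs) (xs 0%N))].

End trajectory.

Section markov.
Context d (T : measurableType d) (R : realType) (P : probability T R).
Context d' (S : measurableType d').

(* The countable set S carries its discrete sigma-algebra. *)
Definition countable_state_space : Prop :=
  countable [set: S] /\ forall x : S, measurable [set x].

Definition stochastic_matrix (p : S -> S -> R) : Prop :=
  (forall x y, (0 <= p x y)%R) /\
  (forall x, \esum_(y in [set: S]) (p x y)%:E = 1).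

(* The Markov property
   P(X_{n+1} = x_{n+1} | X_0 = x_0, ..., X_n = x_n) = p(x_n, x_{n+1})
   multiplied out, so that conditioning events of probability zero need no
   separate treatment.  The law of X_0 is arbitrary; a deterministic starting
   state is the case of a Dirac law. *)
Definition markov_chain (p : S -> S -> R) (X : nat -> {RV P >-> S}) : Prop :=
  stochastic_matrix p /\
  forall (x : nat -> S) (n : nat),
    P [set w | forall i, (i <= n.+1)%N -> X i w = x i] =
    P [set w | forall i, (i <= n)%N -> X i w = x i] * (p (x n) (x n.+1))%:E.

Definition transient (X : nat -> {RV P >-> S}) : Prop :=
  \forall w \ae P, forall x : S, finite_set [set t | X t w = x].

End markov.

(* Main.v *)
Require Import Defs.
From mathcomp Require finmap.
From mathcomp Require Import measurable_realfun.

(** Write A_t for the past {X_0, ..., X_t}, and let e_t be the conditional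
    probability, given X_0, ..., X_{t+1}, that X_{t+1}, X_{t+2}, ... avoid A_t,
    so that the expectation of e_t is the probability that t is a cut-time.

    Fix a time s.  A chain that avoids A_s from time n + 1 on either avoids the
    larger set A_n, or hits A_n and then avoids A_s from the hitting point on.
    Hence, if eps_n is the largest probability of avoiding A_s among the
    starting points in A_n, then eps_{n+1} <= e_n + eps_n.  Since eps_s = 0,
    the probability of avoiding A_s from any point visited by time n is at
    most the sum of the e_t over s <= t < n.  This is a deterministic
    inequality along each trajectory, [avoid_past_le_sum].

    Apply it to the point X_n and take expectations: by the Markov property,
      P(A_s is not visited from time n on)
        <= sum over s <= t < n of P(t is a cut-time).
    As n grows, transience makes the left side tend to 1.  So every tail of
    the series of the P(t is a cut-time) is at least 1, the series diverges,
    and its sum is the expected number of cut-times.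

    All of this is carried out with finite horizons: avoidance is first
    required during k steps only, and each comparison costs k steps, whence
    the horizon m * k after m comparisons.  The horizon is sent to infinity
    at the level of probabilities of events ([avoid_forever_le_sum_cut]).

    Finally, X_t is a cutpoint for every cut-time t, because the only edge of
    the path between A_t and its complement is {X_t, X_{t+1}}; distinct
    cut-times give distinct cutpoints, which bounds the number of cutpoints
    below by the number of cut-times. *)

Set Implicit Arguments.
Unset Strict Implicit.
Unset Printing Implicit Defensive.

Import Order.TTheory GRing.Theory Num.Theory.
Import numFieldNormedType.Exports.

Local Open Scope classical_set_scope.
Local Open Scope ring_scope.
Local Open Scope ereal_scope.

(** * Series, measures and integrals *)

Lemma ge0_esumZl (R : realType) (I : choiceType) (D : set I) (r : R)
    (a : I -> \bar R) : (0 <= r)%R -> (forall i, 0 <= a i) ->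
  \esum_(i in D) (r%:E * a i) = r%:E * \esum_(i in D) a i.
Proof.
move=> r0 a0; rewrite /esum -ereal_supZl//; last first.
  by apply/set0P; exists (\sum_(x \in set0) a x), set0; first exact: fsets_set0.
rewrite image_comp; congr ereal_sup; apply: eq_imagel => A _ /=.
by rewrite ge0_mule_fsumr.
Qed.

(** The tails of a convergent series tend to 0. *)
Lemma nneseries_tail_ge1 (R : realType) (u : nat -> \bar R) :
  (forall t, 0 <= u t) -> (forall s, 1 <= \sum_(s <= t <oo) u t) ->
  \sum_(t <oo) u t = +oo.
Proof.
move=> u0 tail_ge1; have [//|fin] := eqVneq (\sum_(t <oo) u t) +oo.
have /nneseries_tail_cvg : \sum_(t <oo) u t < +oo by rewrite ltey.
move=> /(_ (fun t _ => u0 t)) tail0.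
suff : 1 <= 0 :> \bar R by rewrite lee_fin ler10.
by apply: cvge_ge tail0; exact: nearW.
Qed.

Lemma measure_esum_fibers d (T : measurableType d) (R : realType)
    (mu : {measure set T -> \bar R}) (U : choiceType) (f : T -> U) (B : set T) :
  countable [set: U] -> (forall u, measurable (f @^-1` [set u])) ->
  measurable B -> mu B = \esum_(u in [set: U]) mu (B `&` f @^-1` [set u]).
Proof.
move=> /countable_injP[g g_inj] mf mB.
have {}g_inj : injective g by move=> x y; apply: g_inj; rewrite inE.
have fiberE u : f @^-1` [set u] = (g \o f) @^-1` [set g u].
  by apply/seteqP; split=> w /= => [->//|/g_inj].
rewrite [in LHS](_ : B = \bigcup_(i in range g) (B `&` (g \o f) @^-1` [set i])).
  rewrite measure_bigcup.
  - rewrite nneseries_esum// (_ : [set x | _] = range g); last first.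
      by apply/seteqP; split=> i /=; rewrite inE.
    rewrite esum_image; last by move=> x y _ _; exact: g_inj.
    by apply: eq_esum => u _; rewrite fiberE.
  - by move=> _ [u _ <-]; rewrite -fiberE; exact: measurableI.
  - by move=> i j _ _ [w [[_ /= <-] [_ /= <-]]].
apply/seteqP; split=> [w Bw|w [i _ []//]].
by exists (g (f w)) => //; exists (f w).
Qed.

(** The integral of a nonnegative function is a supremum over the simple
    functions below it, so monotonicity needs no measurability; the number of
    cutpoints is thus compared without proving that it is measurable. *)
Lemma le_integral_nonmeasurable d (T : measurableType d) (R : realType)
    (mu : {measure set T -> \bar R}) (f g : T -> \bar R) :
  (forall w, 0 <= f w) -> (forall w, f w <= g w) ->
  \int[mu]_w f w <= \int[mu]_w g w.
Proof.
move=> f0 fg; have g0 w : 0 <= g w by exact: le_trans (fg w).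
rewrite !ge0_integralTE//; apply: le_ereal_sup => _ [h hf <-].
by exists h => // w; exact: le_trans (fg w).
Qed.

Lemma counting_le_inj (R : realType) (U V : choiceType) (f : U -> V)
    (A : set U) (B : set V) : f @` A `<=` B -> set_inj A f ->
  counting A <= counting B :> \bar R.
Proof.
move=> fAB f_inj; rewrite {2}/counting.
case: asboolP => [finB|]; last by rewrite leey.
have /finite_setP[n fAn] : finite_set (f @` A) by exact: sub_finite_set finB.
have An : (A #= `I_n)%card by rewrite -(card_eql (inj_card_eq f_inj)).
rewrite /counting asboolT; last by apply/finite_setP; exists n.
rewrite lee_fin ler_nat (card_fset_set An) -(card_fset_set fAn).
apply: finmap.fsubset_leq_card; rewrite -fset_set_sub//.
by apply/finite_setP; exists n.
Qed.

(** * Avoidance probabilities of a stochastic matrix *)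

Section avoidance.
Context {R : realType} {S : choiceType}.

Definition past (xs : nat -> S) (s : nat) : set S :=
  [set xs i | i in [set i | (i <= s)%N]].

Variable p : S -> S -> R.

(** The probability that the chain with transition matrix [p] started at [x]
    stays out of [A] at the times 0, ..., k. *)
Fixpoint avoid_prob (A : set S) (k : nat) (x : S) : \bar R :=
  if x \in A then 0 else
  if k is k'.+1 then \esum_(y in [set: S]) ((p x y)%:E * avoid_prob A k' y)
  else 1.

Lemma avoid_prob_in A k x : A x -> avoid_prob A k x = 0.
Proof. by move=> Ax; case: k => [|k] /=; rewrite mem_set. Qed.

Lemma avoid_prob0 A x : ~ A x -> avoid_prob A 0 x = 1.
Proof. by move=> Ax; rewrite /= memNset. Qed.

Lemma avoid_probS A k x : ~ A x ->
  avoid_prob A k.+1 x = \esum_(y in [set: S]) ((p x y)%:E * avoid_prob A k y).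
Proof. by move=> Ax; rewrite /= memNset. Qed.

Hypothesis p_ge0 : forall x y, (0 <= p x y)%R.
Hypothesis p_sum1 : forall x, \esum_(y in [set: S]) (p x y)%:E = 1.

Lemma avoid_prob_ge0 A k x : 0 <= avoid_prob A k x.
Proof.
have [Ax|nAx] := pselect (A x); first by rewrite avoid_prob_in.
elim: k x nAx => [|k IH] x nAx; first by rewrite avoid_prob0.
rewrite avoid_probS//; apply: esum_ge0 => y _.
have [Ay|nAy] := pselect (A y); first by rewrite avoid_prob_in// mule0.
by rewrite mule_ge0 ?lee_fin// IH.
Qed.

Lemma avoid_prob_nonincr A k l x :
  (k <= l)%N -> avoid_prob A l x <= avoid_prob A k x.
Proof.
move=> /subnK <-; elim: (l - k)%N => // {}l; apply: le_trans.
rewrite addSn; elim: (l + k)%N x => {k}[|k IH] x.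
all: have [Ax|nAx] := pselect (A x); first by rewrite !avoid_prob_in.
- rewrite avoid_probS// avoid_prob0// -(p_sum1 x); apply: le_esum => y _.
  rewrite -[leRHS]mule1 lee_wpmul2l ?lee_fin//.
  by rewrite /=; case: ifP.
- rewrite !(avoid_probS _ nAx); apply: le_esum => y _.
  by rewrite lee_wpmul2l ?lee_fin// IH.
Qed.

(** To avoid [A] during m + k steps, the chain must either avoid the larger set
    [B] during k steps, or be in [B] at one of these times and avoid [A] for at
    least m steps from there on, which has probability at most [eps]. *)
Lemma avoid_prob_le_add A B m k (eps : R) : A `<=` B -> (0 <= eps)%R ->
  (forall y, B y -> avoid_prob A m y <= eps%:E) ->
  forall x, avoid_prob A (m + k) x <= avoid_prob B k x + eps%:E.
Proof.
move=> AB eps0 AmB; elim: k => [|k IH] x.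
all: have [Bx|nBx] := pselect (B x);
  first by rewrite (avoid_prob_in _ Bx) add0e (le_trans _ (AmB _ Bx))//
                   avoid_prob_nonincr// leq_addr.
- rewrite avoid_prob0// (@le_trans _ _ 1)//; last by rewrite leeDl// lee_fin.
  rewrite (@le_trans _ _ (avoid_prob A 0 x)) ?avoid_prob_nonincr//=.
  by case: ifP.
- rewrite addnS !avoid_probS//; last by move=> /AB.
  (* One step from a point outside B averages the induction hypothesis
     over p x, and eps is its own average. *)
  have -> : eps%:E = \esum_(y in [set: S]) ((p x y)%:E * eps%:E).
    under eq_esum do rewrite muleC.
    by rewrite ge0_esumZl ?p_sum1 ?mule1// => y; rewrite lee_fin.
  rewrite -esumD; last 2 first.
  - by move=> y _; rewrite mule_ge0 ?lee_fin ?avoid_prob_ge0.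
  - by move=> y _; rewrite mule_ge0 ?lee_fin.
  apply: le_esum => y _; rewrite -ge0_muleDr ?lee_fin ?avoid_prob_ge0//.
  by rewrite lee_wpmul2l ?lee_fin.
Qed.

Lemma avoid_prob_le1 A k x : avoid_prob A k x <= 1.
Proof.
by apply: le_trans (avoid_prob_nonincr A x (leq0n k)) _ => /=; case: ifP.
Qed.

(** The case m = 0 holds because a point of the past of s avoids it with
    probability 0.  A further time step applies [avoid_prob_le_add] with A the
    past of s, B the past of s + m, and eps the bound found so far, which the
    induction hypothesis guarantees at every point of B. *)
Lemma avoid_past_le_sum (xs : nat -> S) (s m k j : nat) : (j <= s + m)%N ->
  avoid_prob (past xs s) (m * k) (xs j) <=
    \sum_(s <= t < s + m) avoid_prob (past xs t) k (xs t.+1).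
Proof.
elim: m j => [|m IH] j.
  by rewrite addn0 big_geq// => js; rewrite avoid_prob_in//; exists j.
have sum_ge0 : 0 <= \sum_(s <= t < s + m) avoid_prob (past xs t) k (xs t.+1).
  by apply: sume_ge0 => t _; exact: avoid_prob_ge0.
rewrite addnS big_nat_recr ?leq_addr//= leq_eqVlt ltnS => /orP[/eqP ->|jsm].
- have fin : \sum_(s <= t < s + m) avoid_prob (past xs t) k (xs t.+1)
      \is a fin_num.
    rewrite ge0_fin_numE//; apply: lte_sum_pinfty => t _.
    exact: le_lt_trans (avoid_prob_le1 _ _ _) (ltry _).
  rewrite mulSn (addnC k) addeC -(fineK fin).
  apply: avoid_prob_le_add => //.
  + move=> _ [i /= si <-]; exists i => //=.
    by rewrite (leq_trans si)// leq_addr.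
  + by rewrite fine_ge0.
  + by move=> _ [i /= ism <-]; rewrite fineK// IH.
- apply: le_trans (avoid_prob_nonincr _ _ _) _; last first.
    by apply: le_trans (IH _ jsm) _; rewrite leeDl// avoid_prob_ge0.
  by rewrite leq_mul2r leqnSn orbT.
Qed.

End avoidance.

(** * Cut-times and cutpoints of a trajectory *)

Section cut.
Context {S : choiceType} (xs : nat -> S).

Lemma cut_timesP t : cut_times xs t <->
  forall i j, (i <= t)%N -> (t < j)%N -> xs i <> xs j.
Proof.
split=> [/= h i j it tj xij|h].
  suff : set0 (xs i) by [].
  by rewrite -h; split; [exists i|exists j].
apply/seteqP; split=> // _ [[i /= it <-] [j /= tj /esym]].
exact: h.
Qed.

Lemma cut_times_inj : set_inj (cut_times xs) xs.
Proof.
move=> t u /set_mem/cut_timesP ht /set_mem/cut_timesP hu xtu.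
by case: (ltngtP t u) => // [tu|ut]; [case: (ht t u)|case: (hu u t)].
Qed.

(** Once X_t is removed, no edge leaves the past of t, so the component of the
    root is contained in this finite set. *)
Lemma cut_time_cutpoint : xs @` cut_times xs `<=` cutpoints xs.
Proof.
move=> _ [t /cut_timesP cut <-]; split; first by exists t.
apply: (@sub_finite_set _ _ (past xs t)); last first.
  by apply: finite_image; exact: (finite_II t.+1).
move=> y [_] path_y; have : past xs t (xs 0%N) by exists 0%N.
elim: path_y => {y} [a b|//|a b c _ IHab _ IHbc /IHab//].
move=> [[_ a_t] [_ b_t] [u ab]] [i /= it ia].
(* The edge ab is {X_u, X_{u+1}}: both ends are in the past if u < t, both
   are in the future if u > t, and X_t is one of them if u = t. *)
have [ut|tu|ut] := ltngtP u t.
- have : [set a; b] b by right.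
  by rewrite ab => -[->|->]; [exists u => //=; exact: ltnW|exists u.+1].
- have : [set a; b] a by left.
  rewrite ab -ia => -[|] xiu; first by case: (cut i u).
  by case: (cut i u.+1 it (leqW tu)).
- have : [set xs u; xs u.+1] (xs u) by left.
  by rewrite -ab ut => -[/esym|/esym].
Qed.

End cut.

(** * Avoidance events of the chain *)

Section chain.
Context d (T : measurableType d) (R : realType) (P : probability T R).
Context d' (S : measurableType d').
Variables (p : S -> S -> R) (X : nat -> {RV P >-> S}).
Hypothesis hS : countable_state_space S.

Let measurable_state (A : set S) : measurable A.
Proof.
apply: countable_measurable; first exact: hS.2.
exact: sub_countable (subset_card_le (@subsetT _ A)) hS.1.
Qed.

Definition traj (w : T) : nat -> S := fun t => X t w.

Lemma measurable_coord n (A : set S) : measurable [set w | A (X n w)].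
Proof. exact: (measurable_funPTI (X n) (measurable_state A)). Qed.

Lemma measurable_coord2 i j (Q : S -> S -> Prop) :
  measurable [set w | Q (X i w) (X j w)].
Proof.
rewrite (_ : [set _ | _] =
    \bigcup_y ([set w | X i w = y] `&` [set w | Q y (X j w)])).
  apply: countable_bigcupT_measurable; first exact: hS.1.
  move=> y; apply: measurableI; first exact: (measurable_coord i [set y]).
  exact: (measurable_coord j (Q y)).
by apply/seteqP; split=> [w Qw|w [y _ [/= ->]]//]; exists (X i w).
Qed.

Definition avoid_fixed (A : set S) n k : set T :=
  [set w | forall j, (n <= j <= n + k)%N -> ~ A (X j w)].

Definition avoid_past s n k : set T :=
  [set w | forall j, (n <= j <= n + k)%N -> ~ past (traj w) s (X j w)].

Definition cylinder n (x : nat -> S) : set T :=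
  [set w | forall i, (i <= n)%N -> X i w = x i].

Lemma measurable_forall_nat (Q : nat -> Prop) (F : nat -> set T) :
  (forall i, measurable (F i)) -> measurable [set w | forall i, Q i -> F i w].
Proof.
move=> mF; rewrite (_ : [set _ | _] = ~` \bigcup_(i in Q) ~` F i).
  by apply: measurableC; apply: bigcup_measurable => i _; exact: measurableC.
by rewrite setC_bigcup; apply/seteqP; split=> w /= h i /h; rewrite setCK.
Qed.

Lemma measurable_avoid_fixed A n k : measurable (avoid_fixed A n k).
Proof.
by apply: measurable_forall_nat => j; exact: (measurable_coord j (~` A)).
Qed.

Lemma avoid_pastE s n k : avoid_past s n k =
  [set w | forall j, (n <= j <= n + k)%N ->
           forall i, (i <= s)%N -> X i w <> X j w].
Proof.
apply/seteqP; split=> w /= h j /h.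
- by move=> nj i si xij; apply: nj; exists i.
- by move=> nj [i /= si /nj].
Qed.

Lemma measurable_avoid_past s n k : measurable (avoid_past s n k).
Proof.
rewrite avoid_pastE; apply: measurable_forall_nat => j.
apply: measurable_forall_nat => i.
exact: (measurable_coord2 i j (fun y z => y <> z)).
Qed.

Lemma measurable_cylinder n x : measurable (cylinder n x).
Proof.
by apply: measurable_forall_nat => i; exact: (measurable_coord i [set x i]).
Qed.

Hypothesis hX : markov_chain p X.
Let p_ge0 := hX.1.1.
Let p_sum1 := hX.1.2.

(** The Markov property over k steps: induction on k, splitting according to the
    value of X_{n+1}, which extends the cylinder by one state. *)
Lemma cylinder_avoid_fixed A k n x :
  P (cylinder n x `&` avoid_fixed A n k) =
  P (cylinder n x) * avoid_prob p A k (x n).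
Proof.
elim: k n x => [|k IH] n x.
all: have [Ax|nAx] := pselect (A (x n)).
1,3: rewrite avoid_prob_in// mule0 (_ : _ `&` _ = set0) ?measure0//;
     apply/seteqP; split=> // w [/= xw /(_ n)];
     by rewrite leqnn leq_addr xw// => /(_ isT).
- rewrite avoid_prob0// mule1; congr (P _); apply/setIidPl => w xw j.
  by rewrite addn0 => /andP[nj jn]; rewrite (@anti_leq j n) ?xw// jn nj.
- rewrite (@measure_esum_fibers _ _ _ _ _ (X n.+1)); last 3 first.
  + exact: hS.1.
  + by move=> y; exact: (measurable_coord n.+1 [set y]).
  + by apply: measurableI;
      [exact: measurable_cylinder|exact: measurable_avoid_fixed].
  have Pfin : P (cylinder n x) \is a fin_num.
    by rewrite fin_num_measure//; exact: measurable_cylinder.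
  rewrite avoid_probS// -(fineK Pfin) -ge0_esumZl; last 2 first.
  + by rewrite fine_ge0.
  + by move=> y; rewrite mule_ge0 ?lee_fin// avoid_prob_ge0.
  apply: eq_esum => y _; rewrite fineK// muleA.
  pose xy i := if (i <= n)%N then x i else y.
  have xyn : xy n.+1 = y by rewrite /xy ltnn.
  rewrite -[in RHS](_ : P (cylinder n.+1 xy) =
                        P (cylinder n x) * (p (x n) y)%:E).
    rewrite -[in RHS]xyn -IH; congr (P _); apply/seteqP; split=> w.
    + move=> [[/= xw avoid_w] Xy]; split=> /=.
      * move=> i; rewrite leq_eqVlt ltnS => /orP[/eqP ->|ni].
          by rewrite Xy xyn.
        by rewrite /xy ni xw.
      * by move=> j /andP[nj jn]; apply: avoid_w; rewrite (ltnW nj) -addSnnS.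
    + move=> [/= xw avoid_w]; have Xx i : (i <= n)%N -> X i w = x i.
        by move=> ni; rewrite xw ?(leq_trans ni)// /xy ni.
      split; last by rewrite /= xw.
      split=> // j /andP[]; rewrite leq_eqVlt => /orP[/eqP <-|nj jn].
        by rewrite Xx.
      by apply: avoid_w; rewrite nj addSnnS.
  rewrite [LHS]hX.2 xyn /xy leqnn; congr (P _ * _).
  by apply/seteqP; split=> w /= h i ni; have := h i ni; rewrite ni.
Qed.

(** Encoding X_0, ..., X_n as one natural number turns the partition of the
    sample space into cylinders into a countable family indexed by nat. *)
Lemma prefix_code : exists g : nat -> T -> nat, forall n,
  (forall v w, g n v = g n w <-> forall i, (i <= n)%N -> X i v = X i w) /\
  (forall i, measurable (g n @^-1` [set i])).
Proof.
have /countable_injP[c c_inj] := hS.1.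
have {}c_inj : injective c by move=> x y; apply: c_inj; rewrite inE.
pose g n w := pickle [seq c (X i w) | i <- iota 0 n.+1].
exists g => n; have gP v w : g n v = g n w <->
    forall i, (i <= n)%N -> X i v = X i w.
  split=> [/(pcan_inj (@pickleK _))/eq_in_map h i ni|h].
    by apply: c_inj; apply: h; rewrite mem_iota.
  congr pickle; apply/eq_in_map => i; rewrite mem_iota add0n => /andP[_ ni].
  by rewrite h.
split=> // i; have [->//|/set0P[v vi]] := eqVneq (g n @^-1` [set i]) set0.
rewrite (_ : _ @^-1` _ = cylinder n (traj v)).
  exact: measurable_cylinder.
by rewrite -vi; apply/seteqP; split=> w /= /gP.
Qed.

(** A function of X_0, ..., X_n is constant on each cell of a countable
    measurable partition, so it is measurable and can be integrated cell by
    cell; the last hypothesis says that it is the conditional probability of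
    [B] given X_0, ..., X_n. *)
Lemma integral_prefix n (F : (nat -> S) -> \bar R) (B : set T) :
  (forall xs ys, (forall i, (i <= n)%N -> xs i = ys i) -> F xs = F ys) ->
  (forall xs, 0 <= F xs) -> measurable B ->
  (forall w, P (cylinder n (traj w) `&` B) =
             P (cylinder n (traj w)) * F (traj w)) ->
  measurable_fun [set: T] (fun w => F (traj w)) /\ \int[P]_w F (traj w) = P B.
Proof.
move=> Fprefix F0 mB PB.
have [g /(_ n)[gP mg]] := prefix_code.
have gF v w : g n v = g n w -> F (traj v) = F (traj w).
  by move=> /gP vw; apply: Fprefix.
have mF : measurable_fun [set: T] (fun w => F (traj w)).
  move=> _ Y _; rewrite setTI (_ : _ @^-1` _ =
      \bigcup_(i in g n @` ((fun w => F (traj w)) @^-1` Y))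
        (g n @^-1` [set i])).
    by apply: bigcup_measurable => i _; exact: mg.
  apply/seteqP; split=> [w Yw|w [_ [v /= Yv <-] /gF]].
    by exists (g n w) => //; exists w.
  by move=> /= ->.
split=> //.
have cells : [set: T] = \bigcup_i (g n @^-1` [set i]).
  by apply/seteqP; split=> // w _; exists (g n w).
have tg : trivIset setT (fun i => g n @^-1` [set i]).
  by move=> i j _ _ [w [/= <- <-]].
rewrite cells ge0_integral_bigcup//; last by rewrite -cells.
rewrite -[in RHS](setIT B) cells setI_bigcupr measure_bigcup//; last 2 first.
- by move=> i _; exact: measurableI.
- exact: trivIset_setIl.
rewrite [RHS](eq_eseriesl (Q := xpredT)); last by move=> i; rewrite in_setT.
apply: eq_eseriesr => i _.
have [->|/set0P[v vi]] := eqVneq (g n @^-1` [set i]) set0.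
  by rewrite setI0 integral_set0 measure0.
have cylE : g n @^-1` [set i] = cylinder n (traj v).
  by rewrite -vi; apply/seteqP; split=> w /= /gP.
rewrite [in RHS]setIC cylE; apply: etrans (esym (PB v)); rewrite -cylE.
rewrite (eq_integral (cst (F (traj v)))); last first.
  by move=> w /[!inE] wi; apply: gF; rewrite wi.
by rewrite integral_cst// muleC.
Qed.

(** The past of s <= n is a fixed set on each cylinder of X_0, ..., X_n, which
    reduces this random obstacle to [cylinder_avoid_fixed]. *)
Lemma integral_avoid_past s n k : (s <= n)%N ->
  measurable_fun [set: T]
    (fun w => avoid_prob p (past (traj w) s) k (X n w)) /\
  \int[P]_w avoid_prob p (past (traj w) s) k (X n w) = P (avoid_past s n k).
Proof.
move=> sn; pose F (xs : nat -> S) := avoid_prob p (past xs s) k (xs n).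
have past_prefix (xs ys : nat -> S) :
    (forall i, (i <= n)%N -> xs i = ys i) -> past xs s = past ys s.
  by move=> xy; apply: eq_imagel => i /= si; rewrite xy// (leq_trans si).
apply: (@integral_prefix n F); rewrite /F.
- by move=> xs ys xy; rewrite (past_prefix _ _ xy) xy.
- by move=> xs; exact: avoid_prob_ge0.
- exact: measurable_avoid_past.
- move=> w; rewrite -cylinder_avoid_fixed; congr (P _).
  by apply/seteqP; split=> v [vw h]; split=> // j /h;
     rewrite (past_prefix _ _ vw).
Qed.

(** The integrated form of [avoid_past_le_sum]. *)
Lemma avoid_past_le_sum_cut s m k :
  P (avoid_past s (s + m) (m * k)) <=
  \sum_(s <= t < s + m) P (avoid_past t t.+1 k).
Proof.
rewrite -(integral_avoid_past _ (leq_addr m s)).2.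
under eq_bigr do rewrite -(integral_avoid_past _ (leqnSn _)).2.
rewrite -ge0_integral_sum//; last 2 first.
- by move=> t; exact: (integral_avoid_past _ (leqnSn t)).1.
- by move=> t w _; exact: avoid_prob_ge0.
apply: ge0_le_integral => //.
- by move=> w _; exact: avoid_prob_ge0.
- exact: (integral_avoid_past _ (leq_addr m s)).1.
- apply: emeasurable_sum => t; exact: (integral_avoid_past _ (leqnSn t)).1.
- move=> w _.
  exact: (avoid_past_le_sum p_ge0 p_sum1 (traj w) k (leqnn (s + m))).
Qed.

(** * Infinite horizon and transience *)

Definition avoid_forever s n : set T :=
  [set w | forall j, (n <= j)%N -> ~ past (traj w) s (X j w)].

Lemma avoid_foreverE s n : avoid_forever s n = \bigcap_k avoid_past s n k.
Proof.
apply/seteqP; split=> w h.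
- by move=> k _ j /andP[nj _]; exact: h.
- by move=> j nj; apply: (h j I); rewrite nj leq_addl.
Qed.

Lemma cut_times_avoid_forever t :
  [set w | cut_times (traj w) t] = avoid_forever t t.+1.
Proof.
apply/seteqP; split=> w /=.
- by move=> /cut_timesP cut j tj [i /= it]; exact: cut.
- by move=> h; apply/cut_timesP => i j it tj ij; apply: (h j tj); exists i.
Qed.

Lemma measurable_avoid_forever s n : measurable (avoid_forever s n).
Proof.
rewrite avoid_foreverE; apply: bigcapT_measurable => k.
exact: measurable_avoid_past.
Qed.

(** The limit k --> oo in [avoid_past_le_sum_cut].  On the left no limit is
    taken: never visiting the past implies not visiting it for m * k steps. *)
Lemma avoid_forever_le_sum_cut s m :
  P (avoid_forever s (s + m)) <=
  \sum_(s <= t < s + m) P (avoid_forever t t.+1).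
Proof.
have cvg_cut t :
    P (avoid_past t t.+1 k) @[k --> \oo] --> P (avoid_forever t t.+1).
  rewrite avoid_foreverE; apply: nonincreasing_cvg_mu.
  - rewrite (le_lt_trans (probability_le1 _ _)) ?ltry//.
    exact: measurable_avoid_past.
  - by move=> k; exact: measurable_avoid_past.
  - by rewrite -avoid_foreverE; exact: measurable_avoid_forever.
  - move=> k l kl; apply/subsetPset => w h j /andP[tj jk]; apply: h.
    by rewrite tj (leq_trans jk)// leq_add2l.
apply: (cvge_ge _ (cvg_nnesum _ (fun t _ => cvg_cut t))); last first.
  by move=> t _; exact: nearW.
apply: nearW => k; apply: le_trans (avoid_past_le_sum_cut s m k).
apply: le_measure; rewrite ?inE.
- exact: measurable_avoid_forever.
- exact: measurable_avoid_past.
- by rewrite avoid_foreverE => w h; exact: h.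
Qed.

Hypothesis htr : transient X.

(** On a transient trajectory the finitely many states of the past of s have a
    last visit. *)
Lemma avoid_forever_cvg1 s : P (avoid_forever s (s + m)) @[m --> \oo] --> 1.
Proof.
have mU : measurable (\bigcup_m avoid_forever s (s + m)).
  by apply: bigcupT_measurable => m; exact: measurable_avoid_forever.
have <- : P (\bigcup_m avoid_forever s (s + m)) = 1.
  rewrite -[X in P X = _]setCK probability_setC; last exact: measurableC.
  rewrite [X in _ - X]measure_negligible ?sube0//; first exact: measurableC.
  apply: negligibleS htr => w /= nU hw; apply: nU.
  have : finite_set [set t | past (traj w) s (X t w)].
    rewrite (_ : [set _ | _] =
        \bigcup_(i in [set i | (i <= s)%N]) [set t | X t w = X i w]).
      by apply: bigcup_finite; [exact: (finite_II s.+1)|move=> i _; exact: hw].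
    by apply/seteqP; split=> t [i is_ ti]; exists i.
  move=> /finite_seqP[r rE]; exists (\max_(t <- r) t).+1 => // j.
  rewrite addnS => rj jpast; suff : (j <= \max_(t <- r) t)%N.
    by rewrite leqNgt (leq_ltn_trans (leq_addl s _) rj).
  by apply: leq_bigmax_seq => //; have : [set` r] j by rewrite -rE.
apply: nondecreasing_cvg_mu => //.
- by move=> m; exact: measurable_avoid_forever.
- move=> m n mn; apply/subsetPset => w h j sj; apply: h.
  by apply: leq_trans sj; rewrite leq_add2l.
Qed.

Lemma sum_cut_ge1 s : 1 <= \sum_(s <= t <oo) P (avoid_forever t t.+1).
Proof.
apply: (cvge_le _ (avoid_forever_cvg1 s)); apply: nearW => m.
apply: le_trans (avoid_forever_le_sum_cut s m) _.
exact: nneseries_lim_ge.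
Qed.

Lemma expected_cut_times : \int[P]_w counting (cut_times (traj w)) = +oo.
Proof.
have diracE t : (fun w => \d_t (cut_times (traj w)) : \bar R) =
    (fun w => (\1_(avoid_forever t t.+1) w)%:E).
  rewrite -cut_times_avoid_forever; apply/funext => w.
  by rewrite /dirac !indicE.
under eq_integral do rewrite counting_dirac.
rewrite integral_nneseries//; last first.
  move=> t; rewrite diracE; apply/measurable_EFinP; apply: measurable_indic.
  exact: measurable_avoid_forever.
rewrite -[RHS](nneseries_tail_ge1 _ sum_cut_ge1)//; apply: eq_eseriesr => t _.
rewrite diracE integral_indic ?setIT//; exact: measurable_avoid_forever.
Qed.

End chain.

(** * The expected numbers of cut-times and cutpoints *)

Theorem theorem2 (d : measure_display) (T : measurableType d) (R : realType)
    (P : probability T R) (d' : measure_display) (S : measurableType d')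
    (p : S -> S -> R) (X : nat -> {RV P >-> S})
    (hS : countable_state_space S) (hX : markov_chain p X)
    (htr : transient X) :
  \int[P]_w counting (cut_times (fun t => X t w)) = +oo /\
  \int[P]_w counting (cutpoints (fun t => X t w)) = +oo.
Proof.
have cut_oo := expected_cut_times hS hX htr; split; first exact: cut_oo.
apply/eqP; rewrite -leye_eq -cut_oo; apply: le_integral_nonmeasurable => w.
  exact: measure_ge0.
exact: counting_le_inj (@cut_time_cutpoint _ _) (@cut_times_inj _ _).
Qed.
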